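(* (i) In every forcibly FAC mean-payoff game with limited-observation $G$, either Eve or Adam has a winning observation-based strategy whose memory is at most exponential in the size of $G$. (ii) For every $n\in\mathbb{N}$ there exists a forcibly FAC mean-payoff game with limited-observation, of size polynomial in $n$, such that every winning observation-based strategy (of the player who wins it) has memory at least $2^n$.
   Context: An MPG with limited-observation is a tuple $G=\langle Q,q_I,\Sigma,\Delta,w,Obs\rangle$: $Q$ finite, $q_I\in Q$, $\Sigma$ finite, $\Delta\subseteq Q\times\Sigma\times Q$ total, $w:\Delta\to\mathbb{Z}$, $Obs$ a partition of $Q$ with $\{q_I\}\in Obs$ and $\mathrm{post}_\sigma(o)=\{q':\exists q\in o,(q,\sigma,q')\in\Delta\}$ a union of elements of $Obs$ for all $o,\sigma$. Plays are infinite abstract paths $o_0\sigma_0o_1\ldots$ starting at $\{q_I\}$; $\gamma(\psi)$ is the set of concrete paths $q_0\sigma_0q_1\ldots$ with $q_i\in o_i$, $(q_i,\sigma_i,q_{i+1})\in\Delta$; $\underline{MP}(\pi)=\liminf_n\frac1n\sum_{i<n}w(q_i,\sigma_i,q_{i+1})$; a play $\psi$ is winning for Eve if $\underline{MP}(\pi)\ge0$ for all $\pi\in\gamma(\psi)$, else for Adam. Observation-based strategies: Eve $\lambda_\exists:\mathrm{Prefs}(G)\to\Sigma$ (finite play prefixes ending in an observation); Adam $\lambda_\forall:\mathrm{Prefs}(G)\times\Sigma\to Obs$ with $\lambda_\forall(o_0\ldots o_n,\sigma)\cap\mathrm{post}_\sigma(o_n)\neq\emptyset$; winning if all consistent plays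 are winning for that player. Eve's strategy has memory $m$ if there are $M$ with $|M|=m$, $m_0\in M$, $\alpha_u:M\times Obs\to M$, $\alpha_o:M\times Obs\to\Sigma$ with $\lambda_\exists(o_0\sigma_0\ldots o_n)=\alpha_o(m_n,o_n)$, $m_{i+1}=\alpha_u(m_i,o_i)$; Adam's has memory $m$ if there are $M$, $m_0$, $\alpha_u:M\times Obs\times\Sigma\to M$, $\alpha_o:M\times Obs\times\Sigma\to Obs$ with $\lambda_\forall(o_0\ldots o_n,\sigma_n)=\alpha_o(m_n,o_n,\sigma_n)$, $m_{i+1}=\alpha_u(m_i,o_i,\sigma_i)$. Let $\mathcal{F}$ be the set of $f:Q\to\mathbb{Z}\cup\{+\infty,\bot\}$, $\mathrm{supp}(f)=\{q:f(q)\ne\bot\}$; $f'$ is a $\sigma$-successor of $f$ if $\mathrm{supp}(f')\in Obs$, $\mathrm{supp}(f')\subseteq\mathrm{post}_\sigma(\mathrm{supp}(f))$ and each $f'(q)$, $q\in\mathrm{supp}(f')$, is $\min\{f(q')+w(q',\sigma,q):q'\in\mathrm{supp}(f),(q',\sigma,q)\in\Delta\}$ or $+\infty$. $f\preceq_k f'$ iff $\mathrm{supp}(f)=\mathrm{supp}(f')$ and $f(q)+k\le f'(q)$ on the support ($+\infty+k=+\infty$). $f_I(q_I)=0$, else $\bot$. $\Pi'_G$: sequences $f_0\sigma_0\ldots f_n$ with $f_0=f_I$, $f_{i+1}$ a $\sigma_i$-successor of $f_i$, and for $0\le i<j<n$: $f_i\not\preceq_0f_j$, $f_j\not\preceq_1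 f_i$, $\mathrm{supp}(f_i)\ne\mathrm{supp}(f_j)$. $\mathcal{T}'_\exists$: sequences in $\Pi'_G$ with $f_i\preceq_0 f_n$ for some $i<n$; $\mathcal{T}'_\forall$: sequences in $\Pi'_G$ with, for some $i<n$, $f_n\preceq_1 f_i$ and $f_i(q)\ne+\infty$ for some $q\in\mathrm{supp}(f_i)$. In $\Gamma'_G$, from $f_I$, Eve picks $\sigma$ and Adam picks $f$ with $x\sigma f\in\Pi'_G$; Eve wins upon reaching $\mathcal{T}'_\exists$, Adam upon reaching $\mathcal{T}'_\forall$. $G$ is forcibly FAC if in $\Gamma'_G$ either Eve can force reaching $\mathcal{T}'_\exists$ or Adam can force reaching $\mathcal{T}'_\forall$. *)

(* Defs.v *)
From HB Require Import structures.
From mathcomp Require Import all_boot all_order all_algebra.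
From mathcomp Require Import all_classical all_reals.
From mathcomp Require Import ereal sequences Rstruct.
Set Implicit Arguments. Unset Strict Implicit. Unset Printing Implicit Defensive.
Import Order.TTheory GRing.Theory Num.Theory.

Definition post_of (Q S : finType) (Del : Q -> S -> Q -> bool) (o : {set Q}) (a : S)
  : {set Q} := [set q' | [exists q in o, Del q a q']].

Record mpg := MPG {
  St : finType;
  Act : finType;
  qI : St;
  Del : St -> Act -> St -> bool;
  wt : St -> Act -> St -> int;           (* w (only relevant on Delta) *)
  Obs : {set {set St}};
  Del_total : forall q a, exists q', Del q a q';
  Obs_partition : finset.partition Obs [set: St];
  qI_obs : [set qI] \in Obs;
  post_union : forall (o : {set St}) (a : Act), o \in Obs ->
     forall o' : {set St}, o' \in Obs ->
       o' \subset post_of Del o a \/ [disjoint o' & post_of Del o a]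
}.

Section Game.
Variable G : mpg.
Local Notation Q := (St G).
Local Notation S := (Act G).
Definition post (o : {set Q}) (a : S) := post_of (@Del G) o a.

(* an abstract path o_0 s_0 o_1 s_1 ... given by two sequences *)
Record aplay := APlay { po : nat -> {set Q}; pa : nat -> S }.

Definition is_play (psi : aplay) : Prop :=
  po psi 0 = [set qI G] /\
  forall i, po psi i \in Obs G /\ po psi i.+1 :&: post (po psi i) (pa psi i) != finset.set0.

Definition concretisation (psi : aplay) (pi : nat -> Q) : Prop :=
  forall i, pi i \in po psi i /\ Del (pi i) (pa psi i) (pi i.+1).

Definition MP (psi : aplay) (pi : nat -> Q) : \bar Rdefinitions.R :=
  limn_einf (fun n : nat =>
    ((\sum_(i < n) (wt (pi i) (pa psi i) (pi i.+1))%:~R) / n%:R : Rdefinitions.R)%:E).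

Definition eve_wins_play (psi : aplay) : Prop :=
  forall pi, concretisation psi pi -> (0%:E <= MP psi pi)%E.

(* a prefix o_0 s_0 ... o_{n-1} s_{n-1} o_n is (h, o_n) with
   h = [:: (o_0,s_0); ...; (o_{n-1},s_{n-1})] *)
Definition hist := seq ({set Q} * S).

Definition prefix_of (psi : aplay) (n : nat) : hist :=
  [seq (po psi i, pa psi i) | i <- iota 0 n].

Definition is_prefix (h : hist) (o : {set Q}) : Prop :=
  exists psi n, is_play psi /\ h = prefix_of psi n /\ o = po psi n.

Definition eve_strategy := hist -> {set Q} -> S.
Definition adam_strategy := hist -> {set Q} -> S -> {set Q}.

Definition adam_valid (l : adam_strategy) : Prop :=
  forall h o a, is_prefix h o ->
    l h o a \in Obs G /\ l h o a :&: post o a != finset.set0.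

Definition eve_consistent (l : eve_strategy) (psi : aplay) : Prop :=
  forall n, pa psi n = l (prefix_of psi n) (po psi n).

Definition adam_consistent (l : adam_strategy) (psi : aplay) : Prop :=
  forall n, po psi n.+1 = l (prefix_of psi n) (po psi n) (pa psi n).

Definition eve_winning (l : eve_strategy) : Prop :=
  forall psi, is_play psi -> eve_consistent l psi -> eve_wins_play psi.

Definition adam_winning (l : adam_strategy) : Prop :=
  adam_valid l /\
  forall psi, is_play psi -> adam_consistent l psi -> ~ eve_wins_play psi.

Definition eve_memory (l : eve_strategy) (m : nat) : Prop :=
  exists (M : finType) (_ : #|M| = m) (m0 : M)
         (au : M -> {set Q} -> M) (ao : M -> {set Q} -> S),
    forall h o, is_prefix h o ->
      l h o = ao (foldl (fun mm p => au mm p.1) m0 h) o.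

Definition adam_memory (l : adam_strategy) (m : nat) : Prop :=
  exists (M : finType) (_ : #|M| = m) (m0 : M)
         (au : M -> {set Q} -> S -> M) (ao : M -> {set Q} -> S -> {set Q}),
    forall h o a, is_prefix h o ->
      l h o a = ao (foldl (fun mm p => au mm p.1 p.2) m0 h) o a.

Inductive xint := XFin of int | XInf.
Definition xadd (x : xint) (k : int) : xint :=
  if x is XFin z then XFin (z + k) else XInf.
Definition xle (x y : xint) : bool :=
  match x, y with
  | _, XInf => true
  | XInf, XFin _ => false
  | XFin a, XFin b => (a <= b)%R
  end.

(* F: f : Q -> Z u {+oo, bot}; None encodes bot *)
Definition F := Q -> option xint.
Definition supp (f : F) : {set Q} := [set q | isSome (f q)].
Definition fval (f : F) (q : Q) : xint := if f q is Some x then x else XInf.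

Definition is_min_pred (f : F) (a : S) (q : Q) (x : xint) : Prop :=
  (exists q', q' \in supp f /\ Del q' a q /\ x = xadd (fval f q') (wt q' a q)) /\
  (forall q', q' \in supp f -> Del q' a q -> xle x (xadd (fval f q') (wt q' a q))).

Definition succ (f : F) (a : S) (f' : F) : Prop :=
  supp f' \in Obs G /\ supp f' \subset post (supp f) a /\
  forall q, q \in supp f' ->
    exists x, f' q = Some x /\ (is_min_pred f a q x \/ x = XInf).

Definition preceq (k : int) (f f' : F) : Prop :=
  supp f = supp f' /\
  forall q, q \in supp f -> xle (xadd (fval f q) k) (fval f' q).

Definition fI : F := fun q => if q == qI G then Some (XFin 0) else None.

(* a sequence f_0 s_0 f_1 ... f_n with f_0 = f_I is encoded by
   p = [:: (s_0,f_1); ...; (s_{n-1},f_n)]; n = size p *)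
Definition fseq (p : seq (S * F)) : seq F := fI :: map snd p.
Definition fat (p : seq (S * F)) (i : nat) : F := nth fI (fseq p) i.

Fixpoint chain (f : F) (p : seq (S * F)) : Prop :=
  if p is (a, f') :: t then succ f a f' /\ chain f' t else True.

Definition inPi (p : seq (S * F)) : Prop :=
  chain fI p /\
  forall i j, i < j -> j < size p ->
    ~ preceq 0 (fat p i) (fat p j) /\ ~ preceq 1 (fat p j) (fat p i) /\
    supp (fat p i) <> supp (fat p j).

Definition inTE (p : seq (S * F)) : Prop :=
  inPi p /\ exists i, i < size p /\ preceq 0 (fat p i) (fat p (size p)).

Definition inTA (p : seq (S * F)) : Prop :=
  inPi p /\ exists i, i < size p /\ preceq 1 (fat p (size p)) (fat p i) /\
    exists q, q \in supp (fat p i) /\ fat p i q <> Some XInf.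

Inductive eve_force : seq (S * F) -> Prop :=
| EF_win p : inTE p -> eve_force p
| EF_step p a : ~ inTA p ->
    (exists f, inPi (rcons p (a, f))) ->
    (forall f, inPi (rcons p (a, f)) -> eve_force (rcons p (a, f))) ->
    eve_force p.

Inductive adam_force : seq (S * F) -> Prop :=
| AF_win p : inTA p -> adam_force p
| AF_step p : ~ inTE p ->
    (forall a, exists f, inPi (rcons p (a, f)) /\ adam_force (rcons p (a, f))) ->
    adam_force p.

Definition forcibly_FAC : Prop := eve_force [::] \/ adam_force [::].

(* size of G: states + actions + binary encoding of the weighted transitions *)
Definition game_size : nat :=
  #|Q| + #|S| +
  \sum_(t : Q * S * Q | Del t.1.1 t.1.2 t.2)
      (trunc_log 2 (absz (wt t.1.1 t.1.2 t.2))).+1.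

End Game.

(* Main.v *)
Require Import Defs.
From mathcomp Require Import all_boot all_order all_algebra.
From mathcomp Require Import all_classical all_reals.
From mathcomp Require Import ereal topology sequences Rstruct.
From mathcomp Require Import zify.
Set Implicit Arguments. Unset Strict Implicit. Unset Printing Implicit Defensive.
Import Order.TTheory GRing.Theory Num.Theory.

(** Upper bound: supports along a branch of the unfolding are distinct observations,
    so branches have length at most [#|Q|], and a player who forces a win in the
    unfolding has a positional strategy there. In the game he follows it and, at a
    leaf closing a cycle, returns to the ancestor that starts the cycle. A node is
    determined by the at most [#|Q|] moves of the opponent leading to it, whence the
    exponential memory. For Eve, the current function bounds the weight of every
    concrete path from below, so partial sums are bounded below. For Adam, every state
    of finite value is the end of a concrete path whose weight is at most that value
    minus the number of returns, returns occur at least every [#|Q| + 1] steps, and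
    Koenig's lemma gives one infinite path of negative mean payoff.

    Lower bound: in each round Adam announces [n + 1] bits, then asks for one of them.
    The bits are not determined by the current observation but only by the weights: a
    hidden pair [(i, c)] gains 1 when bit [i] is announced to be [c] and loses 1 when
    Eve answers [c] to question [i]. A right answer costs nothing, whereas after a
    wrong one some hidden pair has lost 1. With fewer than [2 ^ (n + 1)] memory states
    two announcements are confused in every round, and Adam picks the one answered
    wrongly. *)

(** * Mean payoff estimated from partial sums *)

Lemma limn_einfE (R : realType) (u : nat -> \bar R) :
  limn_einf u = ereal_sup (range (einfs u)).
Proof. by rewrite limn_einf_lim; apply/cvg_lim => //; exact: cvg_einfs_sup. Qed.

Lemma limn_einf_ge (R : realType) (u : nat -> \bar R) (x : \bar R) (N : nat) :
  (forall n, N <= n -> (x <= u n)%E) -> (x <= limn_einf u)%E.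
Proof.
move=> ux; rewrite limn_einfE; apply: le_trans (ereal_sup_ubound _); last first.
  by exists N.
by apply/ereal_infP => _ [n /= Nn <-]; exact: ux.
Qed.

Lemma limn_einf_le (R : realType) (u : nat -> \bar R) (x : \bar R) :
  (forall N, exists2 n, N <= n & (u n <= x)%E) -> (limn_einf u <= x)%E.
Proof.
move=> ux; rewrite limn_einfE; apply: ge_ereal_sup => _ [N _ <-].
by have [n Nn un] := ux N; apply: ge_ereal_inf; exists (u n) => //; exists n.
Qed.

Definition psum (G : mpg) (psi : aplay G) (pi : nat -> St G) (n : nat) : int :=
  (\sum_(i < n) wt (pi i) (pa psi i) (pi i.+1))%R.

Lemma psumS (G : mpg) (psi : aplay G) (pi : nat -> St G) (n : nat) :
  psum psi pi n.+1 = (psum psi pi n + wt (pi n) (pa psi n) (pi n.+1))%R.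
Proof. by rewrite /psum big_ord_recr. Qed.

Lemma MPE (G : mpg) (psi : aplay G) (pi : nat -> St G) :
  MP psi pi = limn_einf (fun n : nat =>
    ((psum psi pi n)%:~R / n%:R : Rdefinitions.R)%R%:E).
Proof. by congr limn_einf; apply/funext => n; rewrite /psum rmorph_sum. Qed.

(** A constant deficit vanishes after division by [n]: past [C / e] steps the average is at least
    [- e]. *)
Lemma MP_ge0 (G : mpg) (psi : aplay G) (pi : nat -> St G) (C : nat) :
  (forall n, - C%:Z <= psum psi pi n)%R -> (0%:E <= MP psi pi)%E.
Proof.
move=> hC; rewrite MPE; apply/lee_subgt0Pr => e e0; rewrite sub0e.
set N := (Num.truncn (C%:R / e)%R).+1; apply: (@limn_einf_ge _ _ _ N) => n Nn.
rewrite -EFinN lee_fin; have n0 : (0 < n%:R :> Rdefinitions.R)%R.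
  by rewrite ltr0n (leq_trans _ Nn).
rewrite ler_pdivlMr // mulNr; apply: (@le_trans _ _ (- C%:Z)%:~R)%R; last first.
  by rewrite ler_int.
rewrite mulrNz lerN2 mulrC -ler_pdivrMr //; apply: ltW.
apply: lt_le_trans (_ : (N%:R <= _)%R); last by rewrite ler_nat.
exact: truncnS_gt.
Qed.

(** Infinitely many averages are at most [- 1 / (d + 1)]; clearing denominators keeps the hypothesis
    in the integers. *)
Lemma MP_lt0 (G : mpg) (psi : aplay G) (pi : nat -> St G) (d : nat) :
  (forall N, exists2 n, N < n & (d.+1%:Z * psum psi pi n <= - n%:Z)%R) ->
  (MP psi pi < 0%:E)%E.
Proof.
move=> hd; rewrite MPE.
apply: (@le_lt_trans _ _ (- d.+1%:R^-1 : Rdefinitions.R)%R%:E); last first.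
  by rewrite lte_fin oppr_lt0 invr_gt0 ltr0n.
apply: limn_einf_le => N; have [n Nn hn] := hd N; exists n; first exact: ltnW.
rewrite lee_fin ler_pdivrMr ?ltr0n ?(leq_ltn_trans _ Nn) //.
rewrite -(@ler_pM2l _ d.+1%:R) ?ltr0n // mulNr mulrN mulVKf ?pnatr_eq0 //.
have : ((d.+1%:Z * psum psi pi n)%:~R <= (- n%:Z)%:~R :> Rdefinitions.R)%R.
  by rewrite ler_int.
by rewrite rmorphM mulrNz.
Qed.

(** * Koenig's lemma for a time-dependent relation on a finite type *)

Section Konig.
Variables (T : finType) (P : nat -> T -> Prop) (E : nat -> T -> T -> Prop).
Hypothesis P_ex : forall t, exists q, P t q.
Hypothesis P_pred : forall t q', P t.+1 q' -> exists2 q, P t q & E t q q'.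

Fixpoint extendable (n t : nat) (q : T) : Prop :=
  if n is n'.+1 then exists2 q', E t q q' & extendable n' t.+1 q' else P t q.

Hypothesis E_P : forall t q q', E t q q' -> P t q.

Lemma extendableW n t q : extendable n.+1 t q -> extendable n t q.
Proof.
elim: n t q => [|n IH] t q /= [q' Eq]; first by move=> _; exact: E_P Eq.
by move=> Hq'; exists q' => //; apply: IH.
Qed.

Lemma extendable_le m n t q : m <= n -> extendable n t q -> extendable m t q.
Proof.
by move=> /subnK <-; elim: (n - m) => // k IH /extendableW; exact: IH.
Qed.

(** By finiteness: if every [q] in [A] failed at some length [g q], none would survive the maximum
    of these lengths. *)
Lemma extendable_cofinal (A : T -> Prop) t :
  (forall n, exists2 q, A q & extendable n t q) ->
  exists2 q, A q & forall n, extendable n t q.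
Proof.
move=> H; apply: contrapT => nH.
have /choice [g gP] : forall q, exists n, A q -> ~ extendable n t q.
  move=> q; have [Aq|nAq] := pselect (A q); last by exists 0.
  apply: contrapT => nq; apply: nH; exists q => // n.
  by apply: contrapT => nE; apply: nq; exists n.
have [q Aq] := H (\max_q g q).
by move=> /(extendable_le (leq_bigmax q)); exact: gP.
Qed.

Lemma extendable_P n t q : extendable n t q -> P t q.
Proof. by case: n => // n [q' /E_P]. Qed.

(** [P_pred] only goes back in time, so the path is grown from its end, at time [t + n]. *)
Lemma extendable_ex n t : exists q, extendable n t q.
Proof.
elim: n t => [|n IH] t; first exact: P_ex.
have [q' qn] := IH t.+1.
by have [q _ Eq] := P_pred (extendable_P qn); exists q, q'.
Qed.

Lemma konig : exists pi, forall t, E t (pi t) (pi t.+1).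
Proof.
have [q0 _ q0P] : exists2 q, True & forall n, extendable n 0 q.
  by apply: extendable_cofinal => n; have [q] := extendable_ex n 0; exists q.
(* Bundling the invariant with the point allows the chosen next point to be iterated. *)
pose X := {x : nat * T | forall n, extendable n x.1 x.2}.
have /choice [nxt nxtP] : forall x : X, exists y : X,
    (sval y).1 = (sval x).1.+1 /\ E (sval x).1 (sval x).2 (sval y).2.
  move=> [[t q] /= qP].
  have [q' Eq' q'P] : exists2 q', E t q q' & forall n, extendable n t.+1 q'.
    by apply: extendable_cofinal => n; exact: qP n.+1.
  by exists (exist _ (t.+1, q') q'P).
pose x0 : X := exist _ (0, q0) q0P.
have tE t : (sval (iter t nxt x0)).1 = t.
  by elim: t => //= t IH; rewrite (nxtP _).1 IH.
exists (fun t => (sval (iter t nxt x0)).2) => t.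
by have := (nxtP (iter t nxt x0)).2; rewrite tE.
Qed.
End Konig.

(** * The unfolding *)

Lemma supp_fI (G : mpg) : supp (@fI G) = [set qI G].
Proof. by apply/setP => q; rewrite !inE /fI; case: (q == qI G). Qed.

Section GameTree.
Variable G : mpg.
Local Notation Q := (St G).
Local Notation S := (Act G).
Implicit Types (p : seq (S * F G)) (f : F G) (o : {set Q}).

Lemma Obs_neq0 o : o \in Obs G -> exists q, q \in o.
Proof.
move=> oO; apply/set0Pn; apply: contraTneq oO => ->.
by case/and3P: (Obs_partition G).
Qed.

Lemma card_Obs : #|Obs G| <= #|Q|.
Proof.
rewrite -cardsT (card_partition (Obs_partition G)) -sum1_card; apply: leq_sum => o.
by case/Obs_neq0 => q qo; rewrite card_gt0; apply/set0Pn; exists q.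
Qed.

Lemma Obs_sub_post o o' a : o \in Obs G -> o' \in Obs G ->
  o' :&: post o a != finset.set0 -> o' \subset post o a.
Proof.
move=> oO o'O; have [//|] := @post_union G o a oO o' o'O.
by rewrite -setI_eq0 => /eqP->; rewrite eqxx.
Qed.

Lemma Obs_meets_post o o' a : o' \in Obs G -> o' \subset post o a ->
  o' :&: post o a != finset.set0.
Proof.
by move=> o'O /finset.setIidPl ->; have [q qo'] := Obs_neq0 o'O; apply/set0Pn; exists q.
Qed.

Lemma Obs_succ_ex o a : o \in Obs G ->
  exists2 o', o' \in Obs G & o' :&: post o a != finset.set0.
Proof.
move=> oO; have [q qo] := Obs_neq0 oO; have [q' qq'] := @Del_total G q a.
have /and3P[/eqP cO _ _] := Obs_partition G.
have : q' \in finset.cover (Obs G) by rewrite cO inE.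
move=> /finset.bigcupP[o' o'O q'o']; exists o' => //; apply/set0Pn; exists q'.
by rewrite !inE q'o'; apply/existsP; exists q; rewrite qo.
Qed.

Lemma is_prefix_Obs (h : hist G) o : is_prefix h o -> o \in Obs G.
Proof. by move=> [psi [n [[_ psiP] [_ ->]]]]; case: (psiP n). Qed.

Lemma prefix_ofS (psi : aplay G) n :
  prefix_of psi n.+1 = rcons (prefix_of psi n) (po psi n, pa psi n).
Proof. by rewrite /prefix_of -(addn1 n) iotaD map_cat cats1 add0n. Qed.

Lemma xle_refl x : xle x x. Proof. by case: x => //= z; exact: lexx. Qed.

Lemma xle_trans y x z : xle x y -> xle y z -> xle x z.
Proof. by case: x y z => [x|] [y|] [z|] //=; exact: le_trans. Qed.

Lemma xle_total x y : xle x y || xle y x.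
Proof. by case: x y => [x|] [y|] //=; exact: le_total. Qed.

Lemma xle_min_seq (T : eqType) (v : T -> xint) (s : seq T) : s != [::] ->
  exists2 x, x \in s & {in s, forall y, xle (v x) (v y)}.
Proof.
elim: s => // x s IH _; have [->|/IH [y ys ymin]] := eqVneq s [::].
  by exists x => [|y]; rewrite inE // => /eqP->; exact: xle_refl.
have [xy|yx] := orP (xle_total (v x) (v y)).
  exists x => [|z]; rewrite inE ?eqxx // => /orP[/eqP->|/ymin]; first exact: xle_refl.
  exact: xle_trans xy.
by exists y => [|z]; rewrite inE ?ys ?orbT // => /orP[/eqP->|/ymin].
Qed.

Lemma is_min_pred_ex f a q : q \in post (supp f) a -> exists x, is_min_pred f a q x.
Proof.
rewrite inE => /exists_inP [q0 q0f q0q].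
have [|q1] := @xle_min_seq _ (fun q' => xadd (fval f q') (wt q' a q))
    (enum [pred q' | (q' \in supp f) && Del q' a q]).
  by apply: contraTneq q0f => /eqP; rewrite -size_eq0 -cardE => /eqP/card0_eq/(_ q0);
     rewrite !inE q0q andbT => ->.
rewrite mem_enum => /andP[q1f q1q] min1.
exists (xadd (fval f q1) (wt q1 a q)); split; first by exists q1.
by move=> q' q'f q'q; apply: min1; rewrite mem_enum inE q'f.
Qed.

(** These are the choices of Adam that never raise a minimum to [XInf]; Eve's strategy follows the
    play along them. *)
Definition min_succ f a f' : Prop :=
  forall q, q \in supp f' -> is_min_pred f a q (fval f' q).

Lemma fvalE f q : q \in supp f -> f q = Some (fval f q).
Proof. by rewrite inE /fval; case: (f q). Qed.

Lemma min_succ_ex f a o : o \in Obs G -> o \subset post (supp f) a ->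
  exists f', [/\ supp f' = o, succ f a f' & min_succ f a f'].
Proof.
move=> oO /fintype.subsetP oP.
have /choice [v vP] : forall q, exists x, q \in o -> is_min_pred f a q x.
  move=> q; have [/oP /is_min_pred_ex [x]|] := boolP (q \in o); last by exists XInf.
  by exists x.
pose f' : F G := fun q => if q \in o then Some (v q) else None.
have sf' : supp f' = o by apply/setP => q; rewrite inE /f'; case: (q \in o).
have f'v q : q \in o -> fval f' q = v q by rewrite /fval /f' => ->.
exists f'; split=> //; last by move=> q; rewrite sf' => qo; rewrite f'v //; exact: vP.
split; first by rewrite sf'.
split=> [|q]; rewrite sf'; first exact/fintype.subsetP.
by move=> qo; exists (v q); rewrite /f' qo; split=> //; left; exact: vP.
Qed.

Definition cur p : F G := fat p (size p).

Lemma curE p : cur p = last (fI (G := G)) (map snd p).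
Proof. by rewrite /cur /fat /fseq (last_nth (fI (G := G))) size_map. Qed.

Lemma fat_rcons p x i : i <= size p -> fat (rcons p x) i = fat p i.
Proof.
by move=> ip; rewrite /fat /fseq map_rcons -rcons_cons nth_rcons /= size_map ltnS ip.
Qed.

Lemma cur_rcons p x : cur (rcons p x) = x.2.
Proof. by rewrite curE map_rcons last_rcons. Qed.

Lemma fat_take p k i : i <= k -> fat (take k p) i = fat p i.
Proof. by case: i => // i ik; rewrite /fat /fseq map_take /= nth_take. Qed.

Lemma chain_rcons f p x :
  chain f (rcons p x) <-> chain f p /\ succ (last f (map snd p)) x.1 x.2.
Proof.
elim: p f => [|[a f'] p IH] f /=; first by case: x => a f' /=; tauto.
by rewrite IH; tauto.
Qed.

Lemma chain_take f p k : chain f p -> chain f (take k p).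
Proof.
by elim: p k f => [|[a f'] p IH] [|k] f //= [ff' /(IH k)].
Qed.

Lemma inPi_take p k : k <= size p -> inPi p -> inPi (take k p).
Proof.
move=> kp [chp dp]; split=> [|i j ij]; first exact: chain_take.
rewrite size_takel // => jk; rewrite !fat_take ?(ltnW jk) ?(ltnW (ltn_trans ij jk)) //.
by apply: dp => //; exact: leq_trans kp.
Qed.

Lemma inPi_rcons p x : inPi (rcons p x) -> inPi p /\ succ (cur p) x.1 x.2.
Proof.
move=> px; split; last by case: px => /chain_rcons [_]; rewrite curE.
have := inPi_take (k := size p) _ px; rewrite size_rcons leqnSn => /(_ isT).
by rewrite -cats1 take_size_cat.
Qed.

(** The conditions of [inPi] on pairs stop before the last function, which may therefore be
    exchanged for any other successor. *)
Lemma inPi_rcons_succ p x y :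
  inPi (rcons p x) -> succ (cur p) y.1 y.2 -> inPi (rcons p y).
Proof.
move=> [/chain_rcons [chp _] dp] py; split; first by apply/chain_rcons; rewrite -curE.
move=> i j ij; rewrite size_rcons => jp.
have /= := dp i j ij; rewrite size_rcons jp !fat_rcons ?(leq_trans (ltnW ij)) //.
exact.
Qed.

(** Once extended, the last function falls under the distinctness condition; hence a node that
    repeats a support has no child. *)
Lemma inPi_rcons_cur p x i : inPi (rcons p x) -> i < size p ->
  supp (fat p i) <> supp (cur p).
Proof.
move=> [_ dp] ip; have := dp i (size p) ip; rewrite size_rcons ltnSn.
by rewrite (fat_rcons _ (ltnW ip)) (fat_rcons _ (leqnn _)) => /(_ isT) [_ []].
Qed.

Lemma chain_supp_Obs p i : chain (fI (G := G)) p -> i <= size p ->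
  supp (fat p i) \in Obs G.
Proof.
elim/last_ind: p i => [|p x IH] i.
  by rewrite leqn0 => _ /eqP->; rewrite /fat /= supp_fI; exact: qI_obs.
move=> /chain_rcons [chp [xO _]]; rewrite size_rcons leq_eqVlt => /orP[/eqP->|].
  by have := cur_rcons p x; rewrite /cur size_rcons => ->.
by rewrite ltnS => ip; rewrite fat_rcons //; exact: IH.
Qed.

(** All functions but the last have distinct supports, which are observations, and [card_Obs] bounds
    their number. *)
Lemma inPi_size p : inPi p -> size p <= #|Q|.
Proof.
move=> [chp dp]; apply: leq_trans card_Obs.
have inj : injective (fun i : 'I_(size p) => supp (fat p i)).
  move=> i j /= ij; apply/val_inj => /=.
  have [ltij|ltji|//] := ltngtP i j.
    by have [_ [_ /(_ ij)]] := dp i j ltij (ltn_ord j).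
  by have [_ [_ /(_ (esym ij))]] := dp j i ltji (ltn_ord i).
rewrite -[size p]card_ord -(card_imset _ inj); apply: subset_leq_card.
by apply/fintype.subsetP => _ /imsetP [i _ ->]; apply: chain_supp_Obs => //; exact: ltnW.
Qed.

(* A positional strategy in the tree makes a node the list of the moves of the
   opponent; reaching a leaf that closes a cycle at depth [i] leads back to the
   ancestor of depth [i]. *)
Section Nodes.
Variables (X : Type) (nxt : seq (S * F G) -> X -> S * F G).
Variables (jmp : seq (S * F G) -> option nat) (force : seq (S * F G) -> Prop).

Definition node (xs : seq X) : seq (S * F G) :=
  foldl (fun p x => rcons p (nxt p x)) [::] xs.

Definition step (xs : seq X) (x : X) : seq X :=
  if jmp (node (rcons xs x)) is Some i then take i (rcons xs x) else rcons xs x.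

Lemma node_rcons xs x : node (rcons xs x) = rcons (node xs) (nxt (node xs) x).
Proof. by rewrite /node foldl_rcons. Qed.

Lemma size_node xs : size (node xs) = size xs.
Proof. by elim/last_ind: xs => // xs x IH; rewrite node_rcons !size_rcons IH. Qed.

Lemma node_take xs k : node (take k xs) = take k (node xs).
Proof.
elim/last_ind: xs => // xs x IH; rewrite node_rcons -!cats1 !take_cat size_node.
case: ltnP => // _; case: (k - size xs) => [|n] /=; first by rewrite !cats0.
by rewrite cats1 node_rcons -cats1.
Qed.

(** Forcing is asked of every ancestor, since a jump may land on any of them. *)
Definition good (xs : seq X) : Prop :=
  [/\ inPi (node xs), jmp (node xs) = None &
      forall i, i <= size xs -> force (take i (node xs))].

Hypothesis jmpP : forall p i, jmp p = Some i ->
  i < size p /\ supp (fat p i) = supp (cur p).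
Hypothesis force_nil : force [::].

Lemma jmp_rcons p x : inPi (rcons p x) -> jmp p = None.
Proof.
by move=> px; case jp : (jmp p) => [i|//]; have [/(inPi_rcons_cur px)] := jmpP jp.
Qed.

Lemma good_nil : good [::].
Proof.
split=> //.
by case jp : (jmp _) => [i|//]; have [] := jmpP jp.
Qed.

(** A jump lands on a proper ancestor with the support of the leaf; having a child, this ancestor
    does not jump itself. *)
Lemma good_step xs x : good xs -> inPi (node (rcons xs x)) ->
  force (node (rcons xs x)) ->
  good (step xs x) /\ supp (cur (node (step xs x))) = supp (nxt (node xs) x).2.
Proof.
move=> [_ _ fxs] pix fx; have cx : cur (node (rcons xs x)) = (nxt (node xs) x).2.
  by rewrite node_rcons cur_rcons.
have fall i : i <= (size xs).+1 -> force (take i (node (rcons xs x))).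
  rewrite leq_eqVlt => /orP[/eqP->|].
    by rewrite take_oversize ?size_node ?size_rcons.
  rewrite ltnS => ixs; rewrite node_rcons -cats1 take_cat size_node.
  case: ltngtP ixs => // [ixs _|-> _]; first by apply: fxs; exact: ltnW.
  by rewrite subnn take0 cats0; have := fxs _ (leqnn _); rewrite take_oversize ?size_node.
rewrite /step; case jp : (jmp _) => [i|]; last first.
  by split; [split=> // i; rewrite size_rcons; exact: fall | rewrite cx].
have [] := jmpP jp; rewrite size_node size_rcons => ix sx.
have ix' : i < size (node (rcons xs x)) by rewrite size_node size_rcons.
split; last first.
  by rewrite -cx -sx node_take {1}/cur size_takel 1?ltnW // fat_take.
(* The prefix of length [i.+1] is a child of the landing node, so [jmp_rcons] applies to the
   latter. *)
have pit : inPi (take i.+1 (node (rcons xs x))) by exact: inPi_take.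
split; rewrite node_take.
- by apply: inPi_take => //; exact: ltnW.
- by move: pit; rewrite (take_nth (nxt [::] x) ix') => /jmp_rcons.
- move=> j; rewrite size_takel; last by rewrite size_rcons ltnW.
  move=> ji.
  by rewrite take_takel //; apply: fall; apply: leq_trans ji (ltnW ix).
Qed.

Lemma good_size xs : good xs -> size xs <= #|Q|.
Proof. by case=> /inPi_size; rewrite size_node. Qed.

End Nodes.
End GameTree.

(** * Strategies from the unfolding *)

Lemma insub_bseqK (T : Type) (n : nat) (s : seq T) :
  size s <= n -> insub_bseq n s = s :> seq T.
Proof. by move=> sn; rewrite /insub_bseq insubdK. Qed.

Lemma xadd0 x : xadd x 0 = x. Proof. by case: x => //= z; rewrite addr0. Qed.

Lemma node_values_bounded (G : mpg) (X : finType)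
    (nxt : seq (Act G * F G) -> X -> Act G * F G) (k : nat) :
  exists C : nat, forall xs : seq X, size xs <= k -> forall q z,
    fval (cur (node nxt xs)) q = XFin z -> (- C%:Z <= z <= C%:Z)%R.
Proof.
pose g (x : k.-bseq X * St G) :=
  if fval (cur (node nxt (val x.1))) x.2 is XFin z then absz z else 0.
exists (\max_x g x) => xs xsk q z qz.
suff : absz z <= \max_x g x by lia.
have := leq_bigmax (F := g) (insub_bseq k xs, q).
by rewrite {1}/g /= insub_bseqK // qz.
Qed.

Section FromForce.
Variable G : mpg.
Local Notation Q := (St G).
Local Notation S := (Act G).

Lemma eve_force_winning : eve_force ([::] : seq (S * F G)) ->
  exists l : eve_strategy G,
    eve_winning l /\ eve_memory l #|{: option (#|Q|.-bseq {set Q})}|.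
Proof.
move=> ef0.
(* A default action is needed. The root closes no cycle, so forcing there comes from [EF_step],
   which provides one. *)
have [a0 _] : exists a0 : S, True.
  have : size ([::] : seq (S * F G)) = 0 by [].
  by case: ef0 => [p [_ [i [ip _]]] p0|p a _ _ _ _]; [rewrite p0 in ip | exists a].
have /choice [act actP] : forall p : seq (S * F G), exists a : S,
    eve_force p -> ~ inTE p -> (exists f, inPi (rcons p (a, f))) /\
    forall f, inPi (rcons p (a, f)) -> eve_force (rcons p (a, f)).
  move=> p; have [efp|] := pselect (eve_force p); last by exists a0.
  by case: efp => [{}p pE|{}p a _ aex aall]; [exists a0 | exists a].
have /choice [nf nfP] : forall x : seq (S * F G) * {set Q}, exists f',
    x.2 \in Obs G -> x.2 \subset post (supp (cur x.1)) (act x.1) ->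
    [/\ supp f' = x.2, succ (cur x.1) (act x.1) f' & min_succ (cur x.1) (act x.1) f'].
  move=> [p o] /=; have [oO|] := boolP (o \in Obs G); last by exists (@fI G).
  have [op|] := boolP (o \subset post (supp (cur p)) (act p)); last by exists (@fI G).
  by have [f' f'P] := min_succ_ex oO op; exists f'.
have /choice [jmp jmpE] : forall p : seq (S * F G), exists r : option nat,
    if r is Some i then i < size p /\ preceq 0 (fat p i) (cur p)
    else forall i, i < size p -> ~ preceq 0 (fat p i) (cur p).
  move=> p; have [[i ip]|nex] := pselect (exists i, i < size p /\ preceq 0 (fat p i) (cur p)).
    by exists (Some i).
  by exists None => i ip pr; apply: nex; exists i.
pose nxt p o := (act p, nf (p, o)).
pose gd := good nxt jmp (@eve_force G).
have jmpP p i : jmp p = Some i -> i < size p /\ supp (fat p i) = supp (cur p).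
  by move=> jp; have := jmpE p; rewrite jp => -[? []].
have good_stp xs o : gd xs -> o \in Obs G ->
    o :&: post (supp (cur (node nxt xs))) (act (node nxt xs)) != finset.set0 ->
    [/\ gd (step nxt jmp xs o), supp (cur (node nxt (step nxt jmp xs o))) = o &
      forall q q', q \in supp (cur (node nxt xs)) -> q' \in o ->
      Del q (act (node nxt xs)) q' ->
      xle (fval (cur (node nxt (step nxt jmp xs o))) q')
        (xadd (fval (cur (node nxt xs)) q) (wt q (act (node nxt xs)) q'))].
  move=> gxs oO om; have [pixs jxs fxs] := gxs; set p := node nxt xs in om *.
  have cO : supp (cur p) \in Obs G by apply: chain_supp_Obs => //; case: pixs.
  have [sf' fsucc fmin] := nfP (p, o) oO (Obs_sub_post cO oO om).
  rewrite /= in sf' fsucc fmin.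
  have efp : eve_force p by have := fxs _ (leqnn _); rewrite take_oversize ?size_node.
  have [|[f pif] fall] := actP _ efp.
    by move=> [_ [i [ip pr]]]; have := jmpE p; rewrite jxs => /(_ i ip).
  have pix : inPi (node nxt (rcons xs o)).
    by rewrite node_rcons; exact: (@inPi_rcons_succ _ _ _ (nxt p o) pif fsucc).
  have efx : eve_force (node nxt (rcons xs o)).
    by move: pix; rewrite node_rcons; exact: fall.
  have [gs ss] := good_step jmpP gxs pix efx.
  split=> //; first by rewrite ss.
  move=> q q' qp q'o qq'.
  have cx : cur (node nxt (rcons xs o)) = nf (p, o) by rewrite node_rcons cur_rcons.
  apply: (@xle_trans (fval (nf (p, o)) q')); last first.
    by have [_] := fmin q' (etrans (congr1 (fun A : {set Q} => q' \in A) sf') q'o); apply.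
  (* A jump leads to a function that is below the current one for [preceq 0], so values only
     decrease and remain lower bounds. *)
  rewrite /step; case jp : (jmp _) => [i|]; last by rewrite cx; exact: xle_refl.
  have := jmpE (node nxt (rcons xs o)); rewrite jp cx => -[ix [si /(_ q')]].
  rewrite si sf' xadd0 => /(_ q'o).
  by rewrite node_take /cur size_takel ?fat_take // ltnW.
(* The memory available at time [n] has not read the current observation yet, so [ao] performs the
   pending move itself; [None] is the memory before the first observation, which leads to the
   root. *)
pose stp (m : option (#|Q|.-bseq {set Q})) o : seq {set Q} :=
  if m is Some xs then step nxt jmp xs o else [::].
pose au m o : option (#|Q|.-bseq {set Q}) := Some (insub_bseq #|Q| (stp m o)).
pose ao m o := act (node nxt (stp m o)).
exists (fun h o => ao (foldl (fun mm x => au mm x.1) None h) o); split; last first.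
  by exists (option (#|Q|.-bseq {set Q})), erefl, None, au, ao.
move=> psi [psi0 psiP] psil pi piP.
have [C CP] := node_values_bounded nxt #|Q|.
pose ms n := foldl (fun mm x => au mm x.1) None (prefix_of psi n).
pose xs n := stp (ms n) (po psi n).
have msS n : ms n.+1 = au (ms n) (po psi n) by rewrite /ms prefix_ofS foldl_rcons.
have aE n : pa psi n = act (node nxt (xs n)) by rewrite psil.
have xsP n : [/\ gd (xs n), supp (cur (node nxt (xs n))) = po psi n &
    xle (fval (cur (node nxt (xs n))) (pi n)) (XFin (psum psi pi n))].
  elim: n => [|n [gn sn vn]].
    split; [exact: good_nil|by rewrite supp_fI psi0|].
    have [] := piP 0; rewrite psi0 inE => /eqP-> _.
    by rewrite /fval /cur /fat /= /fI eqxx /psum big_ord0.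
  have xsS : xs n.+1 = step nxt jmp (xs n) (po psi n.+1).
    by rewrite /xs msS /= insub_bseqK //; exact: good_size gn.
  have [||gs ss vs] := good_stp (xs n) (po psi n.+1) gn.
  - by case: (psiP n.+1).
  - by rewrite sn -aE; case: (psiP n).
  rewrite xsS; split=> //.
  have [[pin Dn] [pin1 _]] := (piP n, piP n.+1).
  apply: xle_trans (vs (pi n) (pi n.+1) _ pin1 _) _; rewrite ?sn -?aE //.
  by move: vn; rewrite psumS; case: (fval _ _) => //= z; rewrite lerD2r.
(* By [xsP] the value at [pi n] is finite and at most the partial sum, and finite values are at
   least [- C]. *)
apply: (@MP_ge0 _ _ _ C) => n; have [gn _] := xsP n.
case vz : (fval _ _) => [z|//] /= zle; apply: le_trans zle.
by have /andP[] := CP _ (good_size gn) _ _ vz.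
Qed.

Lemma adam_force_winning : adam_force ([::] : seq (S * F G)) ->
  exists l : adam_strategy G, adam_winning l /\ adam_memory l #|{: #|Q|.-bseq S}|.
Proof.
move=> af0.
have /choice [nf nfP] : forall x : seq (S * F G) * S, exists f,
    adam_force x.1 -> ~ inTA x.1 ->
    inPi (rcons x.1 (x.2, f)) /\ adam_force (rcons x.1 (x.2, f)).
  move=> [p a] /=; have [afp|] := pselect (adam_force p); last by exists (@fI G).
  case: afp => [{}p pA|{}p _ pall]; first by exists (@fI G).
  by have [f fP] := pall a; exists f.
pose closes (p : seq (S * F G)) i := preceq 1 (cur p) (fat p i) /\
  exists q, q \in supp (fat p i) /\ fat p i q <> Some XInf.
have /choice [jmp jmpE] : forall p : seq (S * F G), exists r : option nat,
    if r is Some i then i < size p /\ closes p i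
    else forall i, i < size p -> ~ closes p i.
  move=> p; have [[i ip]|nex] := pselect (exists i, i < size p /\ closes p i).
    by exists (Some i).
  by exists None => i ip pr; apply: nex; exists i.
have /choice [dflt dfltP] : forall x : {set Q} * S, exists o', x.1 \in Obs G ->
    o' \in Obs G /\ o' :&: post x.1 x.2 != finset.set0.
  move=> [o a] /=; have [oO|] := boolP (o \in Obs G); last by exists o.
  by have [o' o'O om] := Obs_succ_ex a oO; exists o'.
pose nxt p a := (a, nf (p, a)).
pose gd := good nxt jmp (@adam_force G).
pose st := step nxt jmp.
pose f_ xs := cur (node nxt xs).
have jmpP p i : jmp p = Some i -> i < size p /\ supp (fat p i) = supp (cur p).
  by move=> jp; have := jmpE p; rewrite jp => -[? [[]]].
(* The test [size (st xs a) != (size xs).+1] detects a jump. Finite values are traced back to finite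
   values, and [preceq 1] adds 1 to the gap between value and path weight at each jump; [closes]
   ensures that a finite value exists after it. *)
have good_stp xs a : gd xs -> [/\ gd (st xs a),
    supp (f_ (st xs a)) \in Obs G,
    supp (f_ (st xs a)) \subset post (supp (f_ xs)) a,
    (forall q' z', q' \in supp (f_ (st xs a)) -> fval (f_ (st xs a)) q' = XFin z' ->
      exists q z, [/\ q \in supp (f_ xs), fval (f_ xs) q = XFin z, Del q a q' &
        (z + wt q a q' + (size (st xs a) != (size xs).+1)%:Z <= z')%R]) &
    (size (st xs a) != (size xs).+1 -> exists q' z',
      q' \in supp (f_ (st xs a)) /\ fval (f_ (st xs a)) q' = XFin z')].
  move=> gxs; have [pixs jxs fxs] := gxs; set p := node nxt xs in pixs jxs fxs.
  have afp : adam_force p by have := fxs _ (leqnn _); rewrite take_oversize ?size_node.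
  have [|pix afx] := nfP (p, a) afp.
    by move=> [_ [i [ip pr]]]; have := jmpE p; rewrite jxs => /(_ i ip).
  rewrite /= -[rcons _ _]/(rcons p (nxt p a)) -node_rcons in pix afx.
  have [gs ss] := good_step jmpP gxs pix afx; rewrite /= -/p in ss.
  have [_ fsucc] : inPi p /\ succ (cur p) (nxt p a).1 (nxt p a).2.
    by apply: inPi_rcons; rewrite -node_rcons.
  have [sO [spost fval_succ]] := fsucc; rewrite /= in fval_succ.
  have cx : cur (node nxt (rcons xs a)) = nf (p, a) by rewrite node_rcons cur_rcons.
  have pred q' z' : q' \in supp (nf (p, a)) -> fval (nf (p, a)) q' = XFin z' ->
      exists q z, [/\ q \in supp (f_ xs), fval (f_ xs) q = XFin z, Del q a q' &
        (z + wt q a q' = z')%R].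
    move=> q's; have [x [xE [[[q [qs [qq' xq]]] _]|x0]]] := fval_succ q' q's;
      rewrite /fval xE => zE; last by rewrite x0 in zE.
    move: xq; rewrite zE -/p; case fq : (fval _ _) => [z|] //= -[->].
    by exists q, z.
  rewrite /st /f_ ss; split=> //.
    rewrite /step; case jp : (jmp _) => [i|]; last first.
      rewrite size_rcons eqxx cx => q' z' q's /(pred _ _ q's) [q [z [? ? ? zE]]].
      by exists q, z; split=> //; rewrite addr0 zE.
    have := jmpE (node nxt (rcons xs a)); rewrite jp /closes cx => -[ix [[si le1] _]] q' z' q's.
    have {le1} := le1 q' q's; rewrite node_take /cur size_takel 1?ltnW // fat_take //.
    move=> le1 vz'; move: le1; rewrite vz'; case vz : (fval _ _) => [z1|] //= le1.
    have [q [z [? ? ? zE]]] := pred _ _ q's vz.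
    by exists q, z; split=> //; rewrite zE; apply: le_trans le1; case: eqP => /=; lia.
  rewrite /step; case jp : (jmp _) => [i|]; first last.
    by rewrite size_rcons eqxx.
  have := jmpE (node nxt (rcons xs a)); rewrite jp /closes cx => -[ix [[si le1] [q [qs qf]]]] _.
  rewrite node_take /cur size_takel 1?ltnW // fat_take //.
  exists q; have := fvalE qs; move: qs; rewrite -si => qs fE.
  by move: qf; rewrite fE; case: (fval _ _) => [z|] // _; exists z.
pose m0 : #|Q|.-bseq S := [bseq].
pose au (m : #|Q|.-bseq S) (o : {set Q}) (a : S) := insub_bseq #|Q| (st m a).
(* Validity is required on all prefixes: where the memory does not match the observation, because
   the strategy was not followed, a default legal move is made. *)
pose ao (m : #|Q|.-bseq S) (o : {set Q}) (a : S) :=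
  if supp (f_ m) == o then supp (f_ (st m a)) else dflt (o, a).
pose mem (h : hist G) := foldl (fun mm x => au mm x.1 x.2) m0 h.
have mem_rcons h x : mem (rcons h x) = insub_bseq #|Q| (st (mem h) x.2).
  by rewrite /mem foldl_rcons.
have mem_good h : gd (mem h).
  elim/last_ind: h => [|h x IH]; first exact: good_nil.
  have [gs _ _ _ _] := good_stp _ x.2 IH.
  by rewrite mem_rcons insub_bseqK //; exact: good_size gs.
exists (fun h o a => ao (mem h) o a); split; last first.
  by exists (#|Q|.-bseq S), erefl, m0, au, ao.
split=> [h o a /is_prefix_Obs oO|psi [psi0 psiP] psil evew].
  rewrite /ao; case: eqP => [so|_]; last exact: dfltP (o, a) oO.
  have [_ sO spost _ _] := good_stp _ a (mem_good h).
  by split=> //; apply: Obs_meets_post => //; rewrite -so.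
pose xs n := val (mem (prefix_of psi n)).
have xsS n : xs n.+1 = st (xs n) (pa psi n).
  rewrite /xs prefix_ofS mem_rcons /= insub_bseqK //.
  by have [/good_size] := good_stp _ (pa psi n) (mem_good (prefix_of psi n)).
have xs_good n : gd (xs n) by exact: mem_good.
have sxs n : supp (f_ (xs n)) = po psi n.
  elim: n => [|n IH]; first by rewrite psi0 /xs /f_ /= supp_fI.
  by rewrite psil /ao -/(xs n) IH eqxx xsS.
pose J n : bool := size (xs n.+1) != (size (xs n)).+1.
pose P n q := exists2 z, q \in po psi n & fval (f_ (xs n)) q = XFin z.
pose E n q q' := exists z z', [/\ q \in po psi n, fval (f_ (xs n)) q = XFin z,
  fval (f_ (xs n.+1)) q' = XFin z', Del q (pa psi n) q' &
  (z + wt q (pa psi n) q' + (J n)%:Z <= z')%R].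
have E_P n q q' : E n q q' -> P n q by move=> [z [z' [? ? _ _ _]]]; exists z.
have P_pred n q' : P n.+1 q' -> exists2 q, P n q & E n q q'.
  move=> [z' q's vz']; have [_ _ _ + _] := good_stp _ (pa psi n) (xs_good n).
  rewrite -xsS sxs => /(_ q' z' q's vz') [q [z [qs vz qq' le]]].
  by rewrite sxs in qs; exists q; [exists z | exists z, z'].
(* Good nodes have bounded length, so some step from [n] on is a jump; it yields a finite value,
   which [P_pred] traces back to time [n]. *)
have P_ex n : exists q, P n q.
  have [k Jk] : exists k, J (n + k).
    apply: contrapT => nJ.
    have sz k : size (xs (n + k)) = size (xs n) + k.
      elim: k => [|k IH]; first by rewrite !addn0.
      have : ~~ (size (xs (n + k).+1) != (size (xs (n + k))).+1).
        by apply/negP => Jk; apply: nJ; exists k; rewrite /J Jk.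
      by rewrite negbK !addnS IH => /eqP.
    have := good_size (xs_good (n + #|Q|.+1)); rewrite sz; lia.
  have [q] : exists q, P (n + k.+1) q.
    have [_ _ _ _] := good_stp _ (pa psi (n + k)) (xs_good (n + k)).
    move: Jk; rewrite /J -xsS => -> /(_ isT) [q [z [qs vz]]].
    by rewrite sxs in qs; exists q; rewrite addnS; exists z.
  elim: {Jk} k.+1 q => [|j IH] q; first by rewrite addn0 => Pq; exists q.
  by rewrite addnS => /P_pred [q' Pq' _]; exact: IH Pq'.
have [pi piE] := konig P_ex P_pred E_P.
have conc : concretisation psi pi.
  by move=> n; have [z [z' [? _ _ ? _]]] := piE n.
have := evew pi conc; apply/negP; rewrite -ltNge.
pose K n := \sum_(i < n) J i.
have [C CP] := node_values_bounded nxt #|Q|.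
(* The value at [pi n] exceeds the partial sum by at least the number [K n] of jumps so far, and it
   is at most [C]. *)
have sumC n : (psum psi pi n + (K n)%:Z <= C%:Z)%R.
  have [z vz] : exists2 z, fval (f_ (xs n)) (pi n) = XFin z &
      (psum psi pi n + (K n)%:Z <= z)%R.
    elim: n => [|n [z vz IH]].
      exists 0%R; last by rewrite /psum /K !big_ord0.
      have [] := conc 0; rewrite psi0 inE => /eqP-> _.
      by rewrite /f_ /xs /fval /cur /fat /= /fI eqxx.
    have [z1 [z' [_ vz1 vz' _ le]]] := piE n; exists z' => //.
    move: vz1; rewrite vz => -[z1E]; rewrite psumS /K big_ord_recr /= -/(K n).
    by move: le IH; rewrite z1E; lia.
  move/le_trans; apply.
  by have /andP[] := CP _ (good_size (xs_good n)) _ _ vz.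
(* A step lengthens the node by 1 or is a jump, which shortens it by at most [#|Q|]. *)
have Kn n : n <= size (xs n) + #|Q|.+1 * K n.
  elim: n => // n IH; rewrite /K big_ord_recr /= -/(K n).
  have := good_size (xs_good n); rewrite mulnDr {1}/J.
  by move: IH; move: (_ * K n) => t; case: eqP => [->|_] /=; lia.
(* Jumps come at rate at least [1 / (#|Q| + 1)]; half this rate leaves room for the constants once
   the time is large. *)
apply: (@MP_lt0 _ _ _ (#|Q|.*2).+1) => N.
exists (N + (#|Q|.*2).+2 * C.+1 + (#|Q|.*2)).+1; first by lia.
set n := (_ + _).+1; have := good_size (xs_good n); have := Kn n; have := sumC n.
move: (psum _ _ _) (K n) (size _) => s k sz; rewrite /n; nia.
Qed.
End FromForce.

(* The joint play of the two strategies; [dflt] only serves to make it a play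
   before the validity of [la], which speaks about prefixes of plays, is known to
   apply. *)
Lemma not_both_winning (G : mpg) (le : eve_strategy G) (la : adam_strategy G) :
  eve_winning le -> adam_winning la -> False.
Proof.
move=> lewin [lav lawin].
pose ok (o : {set St G}) a (o' : {set St G}) :=
  (o' \in Obs G) && (o' :&: post o a != finset.set0).
have /choice [dflt dfltP] : forall x : {set St G} * Act G, exists o',
    x.1 \in Obs G -> ok x.1 x.2 o'.
  move=> [o a] /=; have [oO|] := boolP (o \in Obs G); last by exists o.
  by have [o' o'O om] := Obs_succ_ex a oO; exists o' => _; rewrite /ok o'O.
pose reply h o a := if ok o a (la h o a) then la h o a else dflt (o, a).
pose nxt (x : hist G * {set St G}) := let a := le x.1 x.2 in
  (rcons x.1 (x.2, a), reply x.1 x.2 a).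
pose x t := iter t nxt ([::], [set qI G]).
pose psi := APlay (fun t => (x t).2) (fun t => le (x t).1 (x t).2).
have hE t : prefix_of psi t = (x t).1.
  by elim: t => // t IH; rewrite prefix_ofS IH.
have okS t : po psi t \in Obs G -> ok (po psi t) (pa psi t) (po psi t.+1).
  by move=> tO; rewrite /= /reply; case: ifP => // _; exact: (dfltP (_, _)).
have tO t : po psi t \in Obs G.
  by elim: t => [|t /okS /andP[]//]; exact: qI_obs.
have play : is_play psi.
  by split=> // t; split=> //; have /andP[] := okS t (tO t).
apply: (lawin psi play _ (lewin psi play _)) => t; last by rewrite hE.
have [] := lav (prefix_of psi t) (po psi t) (pa psi t); first by exists psi, t.
by rewrite hE /= /reply /ok => -> ->.
Qed.

(** * The recall game *)

Lemma succ_ex (G : mpg) (f : F G) a : supp f \in Obs G -> exists f', succ f a f'.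
Proof.
move=> fO; have [o oO om] := Obs_succ_ex a fO.
by have [f' [_ f's _]] := min_succ_ex oO (Obs_sub_post fO oO om); exists f'.
Qed.

Lemma succ_pred (G : mpg) (f f' : F G) a q' : succ f a f' -> q' \in supp f' ->
  exists2 q, q \in supp f & Del q a q'.
Proof.
by move=> [_ [/fintype.subsetP sub _]] /sub; rewrite inE => /exists_inP.
Qed.

(** A lower bound passes to every successor, since replacing a minimum by [XInf] only raises it. *)
Lemma succ_ge (G : mpg) (f f' : F G) a q' (z : int) : succ f a f' -> q' \in supp f' ->
  (forall q, q \in supp f -> Del q a q' -> xle (XFin (z - wt q a q')) (fval f q)) ->
  xle (XFin z) (fval f' q').
Proof.
move=> [_ [_ sf]] q's H; have [x [xE [[[q [qs [qq' xq]]] _]|x0]]] := sf q' q's.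
  move: (H q qs qq'); rewrite {2}/fval xE xq; case: (fval f q) => //= y.
  by rewrite lerBlDr.
by rewrite /fval xE x0.
Qed.

Section RecallGame.
Variable n : nat.
Local Notation I := 'I_n.+1.

(* [None] is the initial state; [Some (inl ((j, b), (i, c)))] follows the
   announcement of bit [b] at position [j], and [Some (inr (i, c))] the question
   "what was bit [i]?"; the pair [(i, c)] is hidden from Eve, except for the
   index [i] of a question. *)
Definition rstate : finType := option ((I * bool) * (I * bool) + I * bool).

Definition rlabel (q : rstate) : option (I * bool + I) :=
  match q with
  | None => None
  | Some (inl (jb, _)) => Some (inl jb)
  | Some (inr (i, _)) => Some (inr i)
  end.

(** The hidden pair is fixed on leaving [None] and kept for the round; Eve's answer enters only the
    weights. *)
Definition rdel (q : rstate) (a : bool) (q' : rstate) : bool :=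
  match q, q' with
  | None, Some (inl ((j, _), _)) => j == ord0
  | Some (inl ((j, _), x)), Some (inl ((j', _), x')) =>
      (nat_of_ord j' == j.+1) && (x == x')
  | Some (inl ((j, _), x)), Some (inr x') => (nat_of_ord j == n) && (x == x')
  | Some (inr _), None => true
  | _, _ => false
  end.

Definition rwt (q : rstate) (a : bool) (q' : rstate) : int :=
  match q with
  | None => 0
  | Some (inl ((j, b), (i, c))) => Posz ((i == j) && (c == b))
  | Some (inr (i, c)) => (- Posz (c == a))%R
  end.

(** The form [in [set: rstate]] is that of the classes of [preim_partition], so that [robsP] holds
    by unfolding. *)
Definition robs (q : rstate) : {set rstate} :=
  [set q' in [set: rstate] | rlabel q == rlabel q'].

Definition rObs : {set {set rstate}} := preim_partition rlabel [set: rstate].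

Lemma rdel_total q a : exists q', rdel q a q'.
Proof.
case: q => [[[[j b] x]|x]|]; last by exists (Some (inl ((ord0, true), (ord0, true)))).
  have [jn|jn] := eqVneq (nat_of_ord j) n.
    by exists (Some (inr x)); rewrite /= jn !eqxx.
  have jn' : j.+1 < n.+1 by have := ltn_ord j; lia.
  by exists (Some (inl ((Ordinal jn', true), x))); rewrite /= !eqxx.
by exists None.
Qed.

Lemma rObs_partition : finset.partition rObs [set: rstate].
Proof. exact: preim_partitionP. Qed.

Lemma robsP (o : {set rstate}) : reflect (exists q, o = robs q) (o \in rObs).
Proof.
apply: (iffP imsetP) => [[q _ ->]|[q ->]]; exists q => //.
Qed.

Lemma robs_eq q q' : rlabel q = rlabel q' -> robs q = robs q'.
Proof. by move=> qq'; apply/setP => x; rewrite !inE qq'. Qed.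

Lemma in_robs q q' : (q' \in robs q) = (rlabel q == rlabel q').
Proof. by rewrite !inE. Qed.

Lemma robs_None : robs None = [set None].
Proof. by apply/setP => -[[[jb x]|[i c]]|]; rewrite in_robs inE. Qed.

Lemma rObs_init : [set None : rstate] \in rObs.
Proof. by apply/robsP; exists None; rewrite robs_None. Qed.

(** Where [q''] has a hidden pair, the predecessor is obtained by giving this pair to [q]. This
    makes the successors of an observation a union of observations. *)
Lemma rdel_transfer q a q' q'' : rdel q a q' -> rlabel q' = rlabel q'' ->
  exists2 q0, rlabel q = rlabel q0 & rdel q0 a q''.
Proof.
case: q => [[[[j b] x]|[i c]]|]; case: q' => [[[[j' b'] x']|[i' c']]|] //=;
  case: q'' => [[[[j'' b''] x'']|[i'' c'']]|] //=.
- move=> /andP[/eqP jj' _] [<- _].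
  by exists (Some (inl ((j, b), x''))); rewrite //= jj' !eqxx.
- move=> /andP[/eqP jn _] [<-].
  by exists (Some (inl ((j, b), (i', c'')))); rewrite //= jn !eqxx.
- by move=> _ _; exists (Some (inr (i, c))).
- by move=> /eqP-> [<- _]; exists None.
Qed.

Lemma rpost_union (o : {set rstate}) (a : bool) : o \in rObs ->
  forall o' : {set rstate}, o' \in rObs ->
  o' \subset post_of rdel o a \/ [disjoint o' & post_of rdel o a].
Proof.
move=> /robsP [q ->] o' /robsP [q' ->].
have [dis|] := boolP [disjoint robs q' & post_of rdel (robs q) a]; first by right.
rewrite -setI_eq0 => /set0Pn [y']; rewrite finset.in_setI in_robs inE => /andP[/eqP q'y'].
move=> /exists_inP [y]; rewrite in_robs => /eqP qy yy'; left.
apply/fintype.subsetP => z; rewrite in_robs q'y' => /eqP y'z.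
have [q0 yq0 q0z] := rdel_transfer yy' y'z.
by rewrite inE; apply/exists_inP; exists q0; rewrite ?in_robs ?qy ?yq0.
Qed.

Definition recall_game : mpg :=
  @MPG rstate bool None rdel rwt rObs rdel_total rObs_partition rObs_init rpost_union.

(** The number of states is quadratic in [n.+1], that of transitions quartic, and each weight takes
    one bit; the exponent is raised from 4 to 200 so that one constant serves as factor and
    exponent. *)
Lemma recall_game_size : game_size recall_game <= 200 * n.+1 ^ 200.
Proof.
have cQ : #|St recall_game| = (n.+1 * 2 * (n.+1 * 2) + n.+1 * 2).+1.
  by rewrite card_option card_sum !card_prod card_ord card_bool.
have w1 q a q' : (trunc_log 2 (absz (rwt q a q'))).+1 = 1.
  case: q => [[[[j b] [i c]]|[i c]]|] //=.
  - by case: (_ && _).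
  - by case: (_ == _).
have -> : game_size recall_game = #|St recall_game| + 2 +
    \sum_(t : rstate * bool * rstate | rdel t.1.1 t.1.2 t.2) 1.
  by rewrite /game_size card_bool; congr (_ + _); apply: eq_bigr => t _; exact: w1.
apply: (@leq_trans (#|St recall_game| + 2 + #|St recall_game| * 2 * #|St recall_game|)).
  rewrite leq_add2l sum1_card; apply: leq_trans (max_card _) _.
  by rewrite !card_prod card_bool.
rewrite cQ; apply: (@leq_trans (200 * n.+1 ^ 4)); last first.
  by rewrite leq_mul2l /= leq_pexp2l.
by rewrite !expnS expn0; nia.
Qed.

(** * Eve's forced win in the unfolding of the recall game *)

Definition rlevel (q : rstate) : nat :=
  match q with
  | None => 0
  | Some (inl ((j, _), _)) => j.+1
  | Some (inr _) => n.+2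
  end.

Lemma rdel_level q a q' : rdel q a q' ->
  if rlevel q == n.+2 then q' = None else rlevel q' = (rlevel q).+1.
Proof.
case: q => [[[[j b] x]|[i c]]|]; case: q' => [[[[j' b'] x']|[i' c']]|] //=;
  rewrite ?eqxx //.
- move=> /andP[/eqP jj' _]; have := ltn_ord j'; rewrite jj'.
  by case: eqP => //; lia.
- by move=> /andP[/eqP -> _]; case: eqP => //; lia.
- by move=> /eqP->.
Qed.

(* A lower bound on the weight accumulated in the current round, where the
   announced bits are [b]. *)
Definition rpot (b : nat -> bool) (q : rstate) : int :=
  match q with
  | None => 0
  | Some (inl ((j, _), (i, c))) => Posz ((i < j) && (c == b i))
  | Some (inr (i, c)) => Posz (c == b i)
  end.

Definition rbits (b : nat -> bool) (q : rstate) : Prop :=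
  if q is Some (inl ((j, b'), _)) then b' = b j else True.

(** Depth and level agree within a round, so supports along a branch differ; [b] collects the bits
    announced so far. *)
Definition rinv (p : seq (Act recall_game * F recall_game)) : Prop :=
  [/\ chain (@fI recall_game) p, size p <= n.+2,
      forall j, j <= size p -> forall q, q \in supp (fat p j) -> rlevel q = j &
      exists b, forall q, q \in supp (cur p) ->
        rbits b q /\ xle (XFin (rpot b q)) (fval (cur p) q)].

Lemma rinv_nil : rinv [::].
Proof.
split=> // [[|//] _ q|].
  by rewrite /fat /= supp_fI inE => /eqP->.
by exists xpredT => q; rewrite /cur /fat /= supp_fI inE => /eqP->.
Qed.

Lemma rinv_supp p i : rinv p -> i < size p -> supp (fat p i) <> supp (cur p).
Proof.
move=> [chp _ lev _] ip.
have [q qi] := Obs_neq0 (chain_supp_Obs chp (ltnW ip)).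
move=> ic; have := lev i (ltnW ip) q qi.
by rewrite ic in qi; have := lev _ (leqnn _) q qi => -> ie; rewrite ie ltnn in ip.
Qed.

Lemma rinv_inPi p a f : rinv p -> succ (cur p) a f -> inPi (rcons p (a, f)).
Proof.
move=> [chp _ lev _] sf; split; first by apply/chain_rcons; rewrite -curE.
move=> i j ij; rewrite size_rcons ltnS => jp.
have ip : i <= size p := ltnW (leq_trans ij jp).
rewrite !fat_rcons //.
have ne : supp (fat p i) <> supp (fat p j).
  move=> sij; have [q qi] := Obs_neq0 (chain_supp_Obs chp ip).
  have := lev i ip q qi; rewrite sij in qi; rewrite (lev j jp q qi) => ji.
  by rewrite ji ltnn in ij.
by split=> [[]|] //; split=> // -[/esym].
Qed.

Lemma rinv_not_inTA p : rinv p -> ~ inTA p.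
Proof.
by move=> ip [_ [i [isz [[si _] _]]]]; apply: (rinv_supp ip isz).
Qed.

Lemma rinv_step p a f : rinv p -> size p < n.+2 -> succ (cur p) a f ->
  rinv (rcons p (a, f)).
Proof.
move=> [chp _ lev [b bP]] sp sf.
have [q0 q0f] := Obs_neq0 sf.1.
have flab q : q \in supp f -> rlabel q = rlabel q0.
  case: sf => /robsP [y yE] _; move: q0f; rewrite yE !in_robs => /eqP <-.
  by move=> /eqP.
have levc q : q \in supp (cur p) -> rlevel q = size p by exact: lev.
(* The new bit overrides [b] at its position. [rpot] reads only positions strictly before the
   current one, because a gain is paid on leaving the announcement. *)
pose b' (k : nat) :=
  if rlabel q0 is Some (inl (j, v)) then if k == j :> nat then v else b k else b k.
split.
- by apply/chain_rcons; rewrite -curE.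
- by rewrite size_rcons.
- move=> j; rewrite size_rcons leq_eqVlt => /orP[/eqP->|].
    move=> q'; have := cur_rcons p (a, f); rewrite /cur size_rcons => -> q'f.
    have [q qc /rdel_level] := succ_pred sf q'f.
    by rewrite levc //; case: eqP => // spE; rewrite spE ltnn in sp.
  by rewrite ltnS => jp q; rewrite fat_rcons //; exact: lev.
exists b' => q' q'f; rewrite cur_rcons /= in q'f *.
have q'lab := flab q' q'f; split.
  rewrite /rbits /b' -q'lab; case: q' {q'f q'lab} => [[[[j v] x]|[i c]]|] //=.
  by rewrite eqxx.
apply: (succ_ge sf q'f) => q qc qq'; have [qb qv] := bP q qc.
have ql := levc q qc.
apply: xle_trans qv => /=; rewrite lerBlDr /b' -q'lab.
case: q qc qq' qb ql {q'f q'lab} => [[[[j v] [i c]]|[i c]]|];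
  case: q' => [[[[j' v'] x']|[i' c']]|] //=.
- move=> _ /andP[/eqP jj' /eqP <-] -> _ /=; rewrite jj' -val_eqE /=.
  have [ji|ij] := ltnP j i.
    by rewrite (_ : (i < j.+1) = false) //; lia.
  rewrite (_ : (nat_of_ord i == j.+1) = false) ?ltnS ?ij /=; last by lia.
  by move: ij; rewrite leq_eqVlt => /orP[/eqP->|ij]; rewrite ?eqxx ?ltnn ?ij ?lerDl.
- move=> _ /andP[/eqP jn /eqP [<- <-]] -> _ /=; rewrite -val_eqE /= jn.
  have : i <= n by have := ltn_ord i.
  by rewrite leq_eqVlt => /orP[/eqP->|ij]; rewrite ?eqxx ?ltnn ?ij ?lerDl.
- by move=> _ _ _ spE; rewrite -spE ltnn in sp.
- by case: x' => i c _ /eqP->.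
Qed.

(** By induction on the number [k] of steps left before the question; until then Eve plays an
    arbitrary action. *)
Lemma recall_eve_force : eve_force ([::] : seq (Act recall_game * F recall_game)).
Proof.
suff H k p : rinv p -> size p + k = n.+2 -> eve_force p by apply: (H n.+2) rinv_nil _.
elim: k p => [|k IH] p pinv; have [chp _ lev [b bP]] := pinv.
  rewrite addn0 => sp; have cO := chain_supp_Obs chp (leqnn _).
  have [q0 q0c] := Obs_neq0 cO.
  have [i [c q0E]] : exists i c, q0 = Some (inr (i, c)).
    have := lev _ (leqnn _) q0 q0c; rewrite sp.
    case: q0 {q0c} => [[[[j v] x]|[i c]]|] //=; last by exists i, c.
    by move=> [jE]; have := ltn_ord j; rewrite jE ltnn.
  (* Eve repeats the announced bit: a pair that loses 1 now has gained 1 before, so the round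
     returns to [None] with a value at least 0 and closes a cycle at [fI]. *)
  apply: (@EF_step _ _ (b i : Act recall_game)); first exact: rinv_not_inTA.
    by have [f fs] := succ_ex (b i : Act recall_game) cO; exists f; exact: rinv_inPi fs.
  move=> f fpi; apply: EF_win; split=> //; exists 0.
  have [_ fs] := inPi_rcons fpi; rewrite /= in fs.
  split; first by rewrite size_rcons.
  have fNone q' : q' \in supp f -> q' = None.
    move=> q'f; have [q qc /rdel_level] := succ_pred fs q'f.
    by rewrite (lev _ (leqnn _) q qc) sp eqxx.
  have [q1 q1f] := Obs_neq0 fs.1; have q1E := fNone q1 q1f.
  rewrite -/(cur _) cur_rcons /=; split.
    apply/setP => q; rewrite /fat /= supp_fI inE; apply/eqP/idP => [->|/fNone //].
    by rewrite -[qI _]/(None : rstate) -q1E.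
  move=> q; rewrite {1}/fat /= supp_fI inE => /eqP->.
  rewrite xadd0 (_ : fval _ (qI _) = XFin 0); last by [].
  rewrite -[qI _]/(None : rstate) -q1E; apply: (succ_ge fs q1f) => q2 q2c _; have [_] := bP q2 q2c.
  apply: xle_trans => /=.
  have : rlabel q0 = rlabel q2.
    by move: cO q0c q2c => /robsP [y ->]; rewrite !in_robs => /eqP <- /eqP.
  rewrite q0E; case: q2 {q2c} => [[[jb x]|[i2 c2]]|] //= [<-].
  by rewrite sub0r opprK.
move=> sp; have cO := chain_supp_Obs chp (leqnn _).
apply: (@EF_step _ _ (true : Act recall_game)); first exact: rinv_not_inTA.
  by have [f fs] := succ_ex (true : Act recall_game) cO; exists f; exact: rinv_inPi fs.
move=> f fpi; have [_ fs] := inPi_rcons fpi; rewrite /= in fs.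
apply: IH; last by rewrite size_rcons addSnnS.
by apply: rinv_step => //; rewrite -sp; lia.
Qed.

(** * Adam's play against a small memory *)

Section MemoryBound.
Variables (M : finType) (au : M -> {set rstate} -> M) (ao : M -> {set rstate} -> bool).

(* The hidden component plays no role in the observation. *)
Definition announce (j : I) (b : bool) : {set rstate} :=
  robs (Some (inl ((j, b), (ord0, true)))).

Definition question (i : I) : {set rstate} := robs (Some (inr (i, true))).

Fixpoint mem_after (m : M) (b : {ffun I -> bool}) (k : nat) : M :=
  if k is k'.+1 then au (mem_after m b k') (announce (inord k') (b (inord k')))
  else au m (robs None).

(** By the pigeonhole principle two announcements lead to the same memory; at a bit where they
    differ, the common answer is wrong for one of them. *)
Lemma wrong_answer m : #|M| < 2 ^ n.+1 -> exists x : {ffun I -> bool} * I,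
  ao (mem_after m x.1 n.+1) (question x.2) = ~~ x.1 x.2.
Proof.
move=> smallM.
have [inj|] := boolP (injectiveb (fun b : {ffun I -> bool} => mem_after m b n.+1)).
  move: smallM; rewrite ltnNge; have := leq_card _ (injectiveP _ inj).
  by rewrite card_ffun card_bool card_ord => ->.
move=> /injectivePn [b [b' bb' memE]].
have [i bi] : exists i, b i != b' i.
  by apply/existsP; apply: contraNT bb' => /existsPn H; apply/eqP/ffunP => i;
     apply/eqP; rewrite -[_ == _]negbK.
have [e|ne] := eqVneq (ao (mem_after m b n.+1) (question i)) (~~ b i).
  by exists (b, i).
exists (b', i); rewrite -[mem_after _ _ _]memE /fst /snd.
by move: ne bi; case: (ao _ _); case: (b i); case: (b' i).
Qed.

(* A configuration records the current state, the memory, and the memory at the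
   beginning of the current round, from which [wrong_answer] determines Adam's
   announcements and question. *)
Definition advance (ch : M -> {ffun I -> bool} * I) (x : rstate * M * M) :
    rstate * M * M :=
  let: (q, m, ms) := x in
  let m' := au m (robs q) in
  match q with
  | None => let: (b, i) := ch m in (Some (inl ((ord0, b ord0), (i, ~~ b i))), m', m)
  | Some (inl ((j, _), y)) =>
      if nat_of_ord j == n then (Some (inr y), m', ms)
      else (Some (inl ((inord j.+1, (ch ms).1 (inord j.+1)), y)), m', ms)
  | Some (inr _) => (None, m', ms)
  end.

(** The path followed carries the pair [(i, ~~ b i)], which never gains during the announcements and
    loses 1 on a wrong answer. *)
Definition coherent (ch : M -> {ffun I -> bool} * I) (x : rstate * M * M) : Prop :=
  let: (q, m, ms) := x in let: (b, i) := ch ms in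
  match q with
  | None => True
  | Some (inl ((j, v), y)) => [/\ v = b j, y = (i, ~~ b i) & m = mem_after ms b j]
  | Some (inr y) => y = (i, ~~ b i) /\ m = mem_after ms b n.+1
  end.

Lemma coherent_advance ch x : coherent ch x -> coherent ch (advance ch x).
Proof.
case: x => [[[[[[j v] y]|y]|] m] ms] /=; last first.
- by move=> _; case chE : (ch m) => [b i] /=; rewrite chE.
- by case: (ch ms).
case chE : (ch ms) => [b i] [-> -> ->]; case: eqP => [jn|jn] /=; rewrite chE /=.
  have -> : mem_after ms b j = mem_after ms b n by rewrite jn.
  have -> : inord n = j by apply/val_inj; rewrite /= inordK.
  by split=> //; congr au; exact: robs_eq.
have jn' : j.+1 < n.+1 by have := ltn_ord j; lia.
split=> //; rewrite inordK //= inord_val; congr au; exact: robs_eq.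
Qed.

Lemma advance_del ch x a : rdel x.1.1 a (advance ch x).1.1.
Proof.
case: x => [[[[[[j v] y]|y]|] m] ms] //=; last by case: (ch m) => b i /=.
case: eqP => [->|jn] /=; rewrite ?eqxx //.
by rewrite inordK ?eqxx //; have := ltn_ord j; lia.
Qed.

Lemma coherent_wt ch x q' :
  (forall m, ao (mem_after m (ch m).1 n.+1) (question (ch m).2) = ~~ (ch m).1 (ch m).2) ->
  coherent ch x ->
  rwt x.1.1 (ao x.1.2 (robs x.1.1)) q' = (- (rlevel x.1.1 == n.+2)%:Z)%R.
Proof.
move=> chP; case: x => [[[[[[j v] [i c]]|[i c]]|] m] ms] //=; have := chP ms;
  case: (ch ms) => b i0 /= ans.
- case=> -> [-> ->] _; rewrite ltn_eqF; last by rewrite ltnS ltn_ord.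
  by case: eqP => [->|] //=; case: (b j).
- case=> -[-> ->] ->; rewrite eqxx (robs_eq (q' := Some (inr (i0, true)))) //.
  by rewrite ans eqxx.
Qed.

End MemoryBound.

Lemma recall_memory (l : eve_strategy recall_game) (s : nat) :
  eve_winning l -> eve_memory l s -> 2 ^ n <= s.
Proof.
move=> lwin [M [<- [m0 [au [ao lE]]]]]; rewrite leqNgt; apply/negP => small.
have smallM : #|M| < 2 ^ n.+1 by rewrite expnS; lia.
have /choice [ch chP] := fun m => @wrong_answer M au ao m smallM.
pose x t := iter t (advance au ch) (None, m0, m0).
pose q t := (x t).1.1; pose m t := (x t).1.2.
pose psi := @APlay recall_game (fun t => robs (q t)) (fun t => ao (m t) (robs (q t))).
have xc t : coherent au ch (x t).
  elim: t => [|t IH]; last exact: coherent_advance.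
  by rewrite /x /=; case: (ch m0).
have conc : concretisation psi q.
  by move=> t; split; [rewrite in_robs | exact: advance_del].
have mS t : m t.+1 = au (m t) (robs (q t)).
  rewrite /m /q /x iterS; case: (iter t _ _) => [[[[[[j v] y]|y]|] m'] ms] //=.
    by case: ifP.
  by case: (ch m').
have playP : is_play psi.
  split; first by rewrite /= robs_None.
  move=> t; split; first by apply/robsP; exists (q t).
  apply/set0Pn; exists (q t.+1); rewrite finset.in_setI in_robs eqxx /= inE.
  by apply/exists_inP; exists (q t); [rewrite in_robs | case: (conc t)].
have memE t : foldl (fun mm z => au mm z.1) m0 (prefix_of psi t) = m t.
  by elim: t => // t IH; rewrite prefix_ofS foldl_rcons IH mS.
have cons : eve_consistent l psi.
  by move=> t; rewrite lE ?memE //; exists psi, t.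
have := lwin psi playP cons q conc; apply/negP; rewrite -ltNge.
(* A round takes [n.+3] steps and costs 1: [k] counts the completed rounds and [rlevel] is the
   position in the current one. *)
have sumE t : exists2 k, t = k * n.+3 + rlevel (q t) & psum psi q t = (- k%:Z)%R.
  elim: t => [|t [k tE sE]]; first by exists 0; rewrite /psum ?big_ord0.
  have := advance_del au ch (x t) true; rewrite -/(q t) -iterS -/(x t.+1) -/(q t.+1).
  move/rdel_level; have wE := coherent_wt (q t.+1) chP (xc t).
  rewrite psumS sE [wt _ _ _]wE -/(q t); case: eqP => [lE' ->|_ ->]; [exists k.+1 | exists k] => //=; lia.
(* The loss rate [1 / (n + 3)] is halved to absorb the unfinished round. *)
apply: (@MP_lt0 _ _ _ (n.+3.*2).-1) => N; exists (N + n.+3.*2).+1; first by lia.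
have [k + ->] := sumE (N + n.+3.*2).+1; move: (q _) => y.
have : rlevel y <= n.+2.
  by case: y => [[[[j v] z]|z]|] //=; have := ltn_ord j; lia.
move: (rlevel y) => lv; lia.
Qed.

End RecallGame.

(** * Counting memory states, and conclusion *)

Lemma card_bseq_bound (T : finType) (k s : nat) : k <= s -> #|T| <= 2 ^ s ->
  #|{: k.-bseq T}| <= 2 ^ (s + s * s).
Proof.
(* Each of the [k + 1 <= 2 ^ s] lengths contributes at most [2 ^ (s * s)] sequences. *)
move=> ks Ts; rewrite card_bseq; apply: (@leq_trans (\sum_(i < k.+1) 2 ^ (s * s))).
  apply: leq_sum => i _; apply: (@leq_trans ((2 ^ s) ^ i)).
    by case: (posnP i) => [->|i0]; rewrite ?expn0 ?leq_exp2r.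
  by rewrite -expnM leq_pexp2l // leq_mul2l (leq_trans _ ks) ?orbT // -ltnS.
rewrite sum_nat_const card_ord expnD leq_mul2r; apply/orP; right.
exact: leq_ltn_trans ks (ltn_expl _ _).
Qed.

(** The successor in [k.+1] counts the state [None] of Eve's memory; [s + s ^ 2 + 1 <= 3 * s ^ 3]
    for [s >= 1]. *)
Lemma force_memory_bound (G : mpg) (k : nat) : k <= 2 ^ (game_size G + game_size G ^ 2) ->
  k.+1 <= 2 ^ (3 * game_size G ^ 3).
Proof.
move=> kb; have s0 : 0 < game_size G.
  have : 0 < #|St G| by apply/card_gt0P; exists (qI G).
  by rewrite /game_size; lia.
apply: (@leq_trans (2 ^ (game_size G + game_size G ^ 2).+1)).
  by rewrite expnS; have := expn_gt0 2 (game_size G + game_size G ^ 2); lia.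
by rewrite leq_pexp2l // !expnS expn0; move: (game_size G) s0 => s; nia.
Qed.

Theorem theorem8 :
  (* (i) exponential memory suffices in forcibly FAC games *)
  (exists c : nat, forall G : mpg, forcibly_FAC G ->
     exists m : nat, m <= 2 ^ (c * (game_size G) ^ c) /\
       ((exists l : eve_strategy G, eve_winning l /\ eve_memory l m) \/
        (exists l : adam_strategy G, adam_winning l /\ adam_memory l m))) /\
  (* (ii) exponential memory is necessary *)
  (exists c : nat, forall n : nat, exists G : mpg,
     forcibly_FAC G /\ game_size G <= c * n.+1 ^ c /\
     ((exists l : eve_strategy G, eve_winning l) \/
      (exists l : adam_strategy G, adam_winning l)) /\
     (forall (l : eve_strategy G) (m : nat),
        eve_winning l -> eve_memory l m -> 2 ^ n <= m) /\
     (forall (l : adam_strategy G) (m : nat),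
        adam_winning l -> adam_memory l m -> 2 ^ n <= m)).
Proof.
split.
  exists 3 => G fac.
  have Qs : #|St G| <= game_size G by rewrite /game_size; lia.
  have Ss : #|Act G| <= 2 ^ game_size G.
    by apply: ltnW; apply: leq_ltn_trans (ltn_expl _ _) => //; rewrite /game_size; lia.
  case: fac => [/eve_force_winning|/adam_force_winning] [l [lwin lmem]].
    exists #|{: option (#|St G|.-bseq {set St G})}|; split; last by left; exists l.
    rewrite card_option; apply: force_memory_bound; apply: card_bseq_bound => //.
    by rewrite -cardsT -powersetT card_powerset cardsT leq_pexp2l.
  exists #|{: #|St G|.-bseq (Act G)}|; split; last by right; exists l.
  by apply: ltnW; apply: force_memory_bound; apply: card_bseq_bound.
exists 200 => n; exists (recall_game n).
have [le [lewin _]] := eve_force_winning (recall_eve_force n).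
split; first by left; exact: recall_eve_force.
split; first exact: recall_game_size.
split; first by left; exists le.
split; first exact: recall_memory.
(* Eve's winning strategy excludes one for Adam, so the bound on his memory holds vacuously. *)
by move=> la m /(not_both_winning lewin).
Qed.
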